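(* Let $X$, $\xi\colon S\to\mathbb C^1$, $b$, $U'\subseteq U\subseteq X\subset\mathbb C^n$ and the field of deformation speeds $\overline v$ (a section of $\Theta_{\mathbb C^n}|_{U'}$) be as in the context. Then there exists a section $v'\in\Gamma(U,\mathcal N_{X\subseteq\mathbb C^n})$ such that $v'|_{U'}$ coincides with the image of $\overline v$ under the canonical map of sheaves $\Theta_{\mathbb C^n}|_{U'}\to\mathcal N_{X\subseteq\mathbb C^n}|_{U'}$. Denote by $\nu\in H^1(U,\Theta_U)$ the image of $v'$ under the connecting (snake) map of the exact sequence of sheaves $$0\to\Theta_U\to\Theta_{\mathbb C^n}|_U\to\mathcal N_{X\subseteq\mathbb C^n}|_U\to0 .$$ Then, under the identification $T^1(X)=\ker\bigl(H^1(U,\Theta_X)\to H^1(U,\mathcal O_X^{\oplus n})\bigr)$, the class $\nu$ represents the first order deformation $\varepsilon\colon\widetilde S\to\mathrm{Spec}\,\mathbb C[\varepsilon]/\varepsilon^2$ obtained by restricting $\xi\colon S\to\mathbb C^1$ to the double point at the origin of $\mathbb C^1$ corresponding to the tangent vector $\partial/\partial\xi$.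
   Context: Setting. $X$ is a normal affine variety over $\mathbb C$ and $\xi\colon S\to\mathbb C^1$ is a deformation of $X$ over the affine line: $S$ is a variety, $\xi$ is flat, and the scheme-theoretic fiber $\xi^{-1}(0)$ is $X$. $S$ is a closed subvariety of a vector space $\mathbb C^{1+n}$ with coordinates $\xi,\check x_1,\dots,\check x_n$; $x_i\in\mathbb C[S]$ is the restriction of $\check x_i$. Thus $X\subset\{\xi=0\}=\mathbb C^n$, with ideal $I\subset\mathbb C[\check x_1,\dots,\check x_n]$. $b\colon\mathbb C^{k+1}\to S$ is a dominant morphism from the affine space with coordinates $y_0,\dots,y_k$ such that: (i) $\xi\circ b=y_0$; (ii) $b|_{y_0=0}$ is a dominant morphism to $X$; (iii) $b|_{y_0=0}$ maps $\{y_0=0\}$ birationally to $X$. $U\subseteq X$ is a smooth open subset with $\mathrm{codim}_X(X\setminus U)\ge2$, and $U'\subseteq U$ is a (nonempty) open subset on which $(b|_{y_0=0})^{-1}$ is defined. For $x\in U'$ let $v(x)=d_{(b|_{y_0=0})^{-1}(x)}b\,(\partial/\partial y_0)$, a tangent vector to $\mathbb C^{1+n}$ at $x$ (its $\partial/\partial\xi$-coordinate is $1$). The field of deformation speeds $\overline v$ is the projection of $v$ to $\Theta_{\mathbb C^n}$, i.e. $v$ with the $\partial/\partial\xi$-component dropped. $\Theta$ denotes tangent sheaves and $\mathcal N_{X\subseteq\mathbb C^n}$ the normal sheaf $\mathcal Hom_X(I/I^2,\mathcal O_X)$ (over $U$, the normal bundle). $T^1$. $T^1(X)=\mathrm{coker}\bigl(\phi\colon\mathrm{Der}\,\mathbb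 C[\check x_1,\dots,\check x_n]\to\mathrm{Hom}_{\mathbb C[X]}(I/I^2,\mathbb C[X])\bigr)$, $\phi(\sum g_i\partial/\partial\check x_i)(g)=\sum g_i\partial g/\partial\check x_i\bmod I$. A first order deformation $\mathrm{Spec}\,B\to\mathrm{Spec}\,\mathbb C[\varepsilon]/\varepsilon^2$ of $X$, after choosing lifts $\widetilde x_i\in B$ of the $x_i|_X$, is represented by the map $I/I^2\to\mathbb C[X]$, $g\mapsto g'\bmod I$, where $g(\widetilde x_1,\dots,\widetilde x_n)=\varepsilon g'(\widetilde x_1,\dots,\widetilde x_n)$ in $B$. Identification with cohomology. The map $H^1(U,\Theta_X)\to H^1(U,\mathcal O_X^{\oplus n})$ is induced by $\psi\colon\Theta_X\to\mathcal O_X^{\oplus n}$, $w\mapsto(dx_1(w),\dots,dx_n(w))$. On $U$ there is an exact sequence $0\to\Theta_X|_U\to\mathcal O_X^{\oplus n}|_U\to(\mathcal I^\vee)|_U\to0$, where $\mathcal I^\vee$ is the sheaf on $X$ with $\Gamma(X,\mathcal I^\vee)=\mathrm{Hom}_{\mathbb C[X]}(I/I^2,\mathbb C[X])$, the first map is $\psi$ and the second is induced by $\phi$; restriction gives $\mathrm{Hom}_{\mathbb C[X]}(I/I^2,\mathbb C[X])=\Gamma(U,\mathcal I^\vee)$, and the identification $T^1(X)=\ker(H^1(U,\Theta_X)\to H^1(U,\mathcal O_X^{\oplus n}))$ is induced by the connecting homomorphism $\Gamma(U,\mathcal I^\vee)\to H^1(U,\Theta_X)$. *)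

(* Defs.v *)
(* Affine varieties are Zariski closed irreducible sets of points, and their
   coordinate rings are presented as polynomials modulo the vanishing ideal.
   Sections of sheaves on an open incl V of X are functions of points; they
   are only meaningful, and are only compared, at the points of V. *)
From HB Require Import structures.
From mathcomp Require Import all_boot all_order all_algebra.
From mathcomp Require Import complex mpoly reals.

Set Implicit Arguments.
Unset Strict Implicit.
Unset Printing Implicit Defensive.

Import GRing.Theory.
Local Open Scope ring_scope.

Definition pt (K : Type) (n : nat) := 'I_n -> K.

Definition incl (T : Type) (A B : T -> Prop) := forall x, A x -> B x.

Definition setint (T : Type) (A B : T -> Prop) : T -> Prop :=
  fun x => A x /\ B x.

Definition setminus (T : Type) (A B : T -> Prop) : T -> Prop :=
  fun x => A x /\ ~ B x.

Section Zariski.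

Variables (K : fieldType) (n : nat).
Implicit Types (X Y Z U V W : pt K n -> Prop) (p q f g h : {mpoly K[n]}).

Definition vanishing X g := forall x, X x -> g.@[x] = 0.

Definition zclosed Z := exists E : {mpoly K[n]} -> Prop,
  forall x, Z x <-> (forall g, E g -> g.@[x] = 0).

Definition zopen X V := exists2 Z, zclosed Z &
  forall x, V x <-> setminus X Z x.

Definition irreducible X := (exists x, X x) /\
  forall Z1 Z2, zclosed Z1 -> zclosed Z2 ->
    incl X (fun x => Z1 x \/ Z2 x) -> incl X Z1 \/ incl X Z2.

Definition variety X := zclosed X /\ irreducible X.

(* The coordinate ring is integrally closed in its field of fractions: if
   p / q satisfies a monic equation over it then q divides p. *)
Definition normal_variety X := forall p q, ~ vanishing X q ->
  forall (m : nat) (a : 'I_m -> {mpoly K[n]}),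
    vanishing X (p ^+ m + \sum_(i < m) a i * p ^+ i * q ^+ (m - i)) ->
    exists r, vanishing X (p - r * q).

Definition dominant (T : Type) (phi : T -> pt K n) X :=
  forall Z, zclosed Z -> (forall y, Z (phi y)) -> incl X Z.

(* Y = Z_0 < Z_1 < ... < Z_c, contained in X *)
Definition chain_from X Y (c : nat) := exists Zs : nat -> pt K n -> Prop,
  [/\ forall x, Zs 0%N x <-> Y x,
      forall i, (i <= c)%N -> variety (Zs i),
      forall i, (i < c)%N ->
        incl (Zs i) (Zs i.+1) /\ ~ incl (Zs i.+1) (Zs i) &
      incl (Zs c) X].

Definition dim_is X (d : nat) :=
  (exists Y, chain_from X Y d) /\ ~ (exists Y, chain_from X Y d.+1).

Definition codim_ge X Z (c : nat) :=
  forall Y, variety Y -> incl Y Z -> chain_from X Y c.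

Definition tangent_vector X (x : pt K n) (w : 'rV[K]_n) :=
  forall g, vanishing X g -> \sum_(i < n) w 0 i * (g^`M(i)).@[x] = 0.

Definition smooth_at X (x : pt K n) := exists d (T : {vspace 'rV[K]_n}),
  [/\ dim_is X d, forall w, w \in T <-> tangent_vector X x w & \dim T = d].

(* f is in O_X(V) *)
Definition regular X V (f : pt K n -> K) := forall x, V x ->
  exists W p q, [/\ zopen X W, W x, incl W V &
    forall y, W y -> q.@[y] != 0 /\ f y = p.@[y] / q.@[y]].

Definition polynomial_on X (f : pt K n -> K) :=
  exists p, forall x, X x -> f x = p.@[x].

(* Presheaves of families of functions: a section over V is a family of
   functions on V, only the members with an index in dom being relevant;
   restriction maps are restrictions of functions. *)
Record presheaf := Presheaf {
  idx : Type;
  dom : idx -> Prop;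
  sec : (pt K n -> Prop) -> (idx -> pt K n -> K) -> Prop }.

Definition sections (F : presheaf) := idx F -> pt K n -> K.

Definition eq_on (F : presheaf) V (s t : sections F) :=
  forall e, dom e -> forall x, V x -> s e x = t e x.

(* O_X^n, also the restriction to X of the tangent sheaf of the affine
   n-space, a family (a_i) being the vector field \sum_i a_i d/dx_i. *)
Definition sheaf_On X : presheaf :=
  @Presheaf 'I_n (fun=> True) (fun V a => forall i, regular X V (a i)).

(* D is in Der_K(K[X], O_X(V)); a derivation of K[X] is a derivation on
   polynomials that kills the ideal of X. *)
Definition derivation X V (D : {mpoly K[n]} -> pt K n -> K) :=
  [/\ forall p, regular X V (D p),
      forall (c : K) p q x, V x -> D (c *: p + q) x = c * D p x + D q x,
      forall p q x, V x -> D (p * q) x = p.@[x] * D q x + q.@[x] * D p x &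
      forall g x, vanishing X g -> V x -> D g x = 0].

(* The tangent sheaf Hom(Omega_X, O_X); as X is affine, its sections over V
   are Der_K(K[X], O_X(V)). *)
Definition sheaf_Theta X : presheaf :=
  @Presheaf {mpoly K[n]} (fun=> True) (derivation X).

(* phi is in Hom_{K[X]}(I/I^2, M), for I the ideal of X and M a K[X]-module
   of functions on V; only the values of phi on I matter. *)
Definition conormal_hom X V (M : (pt K n -> K) -> Prop)
    (phi : {mpoly K[n]} -> pt K n -> K) :=
  [/\ forall g, vanishing X g -> M (phi g),
      forall p g h x, vanishing X g -> vanishing X h -> V x ->
        phi (p * g + h) x = p.@[x] * phi g x + phi h x &
      forall g h x, vanishing X g -> vanishing X h -> V x ->
        phi (g * h) x = 0].

(* The normal sheaf Hom_X(I/I^2, O_X); as X is affine and the sheaf I/I^2 is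
   associated with a module, its sections over V are
   Hom_{K[X]}(I/I^2, O_X(V)). *)
Definition sheaf_N X : presheaf :=
  @Presheaf {mpoly K[n]} (vanishing X)
    (fun V => conormal_hom X V (regular X V)).

(* psi(w) = (dx_1(w), ..., dx_n(w)) *)
Definition psi X (D : sections (sheaf_Theta X)) : sections (sheaf_On X) :=
  fun i => D 'X_i.

(* \sum_i a_i d/dx_i |-> (g |-> \sum_i a_i dg/dx_i) *)
Definition to_normal X (a : sections (sheaf_On X)) : sections (sheaf_N X) :=
  fun g x => \sum_(i < n) a i x * (g^`M(i)).@[x].

Definition open_cover X U (J : Type) (W : J -> pt K n -> Prop) :=
  (forall j, zopen X (W j)) /\ (forall x, U x <-> exists j, W j x).

(* First cohomology is Cech cohomology, the colimit over all open covers of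
   U; its elements are represented by cocycles on some cover, two cocycles
   being identified when they are cohomologous. *)
Record cochain (F : presheaf) := Cochain {
  cidx : Type;
  cov : cidx -> pt K n -> Prop;
  cval : cidx -> cidx -> sections F }.

Definition cocycle X (F : presheaf) U (c : cochain F) :=
  [/\ open_cover X U (@cov F c),
      forall i j, sec (setint (cov i) (cov j)) (@cval F c i j) &
      forall i j k, eq_on (setint (cov i) (setint (cov j) (cov k)))
        (@cval F c i k) (fun e x => cval i j e x + cval j k e x)].

Definition cohomologous X (F : presheaf) U (c c' : cochain F) :=
  exists (J : Type) (W : J -> pt K n -> Prop) (r : J -> cidx c)
      (r' : J -> cidx c') (b : J -> sections F),
    [/\ open_cover X U W,
        forall j, incl (W j) (cov (r j)) /\ incl (W j) (cov (r' j)),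
        forall j, sec (W j) (b j) &
        forall j l, eq_on (setint (W j) (W l))
          (fun e x => cval (r j) (r l) e x - cval (r' j) (r' l) e x)
          (fun e x => b l e x - b j e x)].

Definition zero_cochain (F : presheaf) U : cochain F :=
  @Cochain F unit (fun=> U) (fun _ _ _ _ => 0).

Definition map_cochain (F G : presheaf) (alpha : sections F -> sections G)
    (c : cochain F) : cochain G :=
  @Cochain G (cidx c) (@cov F c) (fun i j => alpha (cval i j)).

(* The class of nu is the image of s under the connecting map of
   0 -> A -> B -> C -> 0: locally lift s to sections w_i of B, and take the
   class of the cocycle of A mapping to w_j - w_i. *)
Definition connecting X (A B C : presheaf) (alpha : sections A -> sections B)
    (beta : sections B -> sections C) U (s : sections C) (nu : cochain A) :=
  cocycle X U nu /\
  exists (z : cochain A) (w : cidx z -> sections B),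
    [/\ cocycle X U z,
        forall i, sec (cov i) (w i) /\ eq_on (cov i) (beta (w i)) s,
        forall i j, eq_on (setint (cov i) (cov j)) (alpha (cval i j))
          (fun e x => w j e x - w i e x) &
        cohomologous X U z nu].

Definition normal_connecting X :=
  @connecting X (sheaf_Theta X) (sheaf_On X) (sheaf_N X)
    (@psi X) (@to_normal X).

(* h is in Hom_{K[X]}(I/I^2, K[X]), whose quotient by the image of
   Der K[x_1, ..., x_n] is T^1(X) *)
Definition conormal_dual X (h : sections (sheaf_N X)) :=
  conormal_hom X X (polynomial_on X) h.

Definition T1_equiv X (h h' : sections (sheaf_N X)) :=
  exists a : 'I_n -> {mpoly K[n]},
    eq_on X h (fun g x => h' g x + to_normal (X := X) (fun i y => (a i).@[y]) g x).

(* The identification T^1(X) = ker (H^1(U, Theta_X) -> H^1(U, O_X^n)) maps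
   the class of h to the class of nu. *)
Definition T1_identified X U (h : sections (sheaf_N X))
    (nu : cochain (sheaf_Theta X)) :=
  [/\ conormal_dual h, normal_connecting U h nu &
      cohomologous X U (map_cochain (@psi X) nu)
        (zero_cochain (sheaf_On X) U)].

(* V is a nonempty open incl of X on which the rational map inverse to
   phi : K^k -> X is defined and given by beta. *)
Definition rational_inverse_on X k (phi : pt K k -> pt K n) V
    (beta : pt K n -> pt K k) :=
  [/\ zopen X V, exists x, V x,
      forall j, regular X V (fun x => beta x j),
      forall x, V x -> forall i, phi (beta x) i = x i &
      forall y, V (phi y) -> forall j, beta (phi y) j = y j].

Definition birational X k (phi : pt K k -> pt K n) :=
  exists V beta, rational_inverse_on X phi V beta.

End Zariski.

Section Deformation.

Variables (K : fieldType) (n : nat).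
Implicit Types (X : pt K n -> Prop) (S : pt K n.+1 -> Prop).

(* The coordinates of the (1+n)-space are xi = 'X_ord0 and
   x_i = 'X_(lift ord0 i). *)
Definition xi : {mpoly K[n.+1]} := 'X_ord0.

Definition xtilde0 : 'I_n -> {mpoly K[n.+1]} := fun i => 'X_(lift ord0 i).

(* g(t_1, ..., t_n) *)
Definition subst (g : {mpoly K[n]}) (t : 'I_n -> {mpoly K[n.+1]}) :
    {mpoly K[n.+1]} := g \mPo [tuple t i | i < n].

(* f is in I(S) + (xi^m) *)
Definition ideal_plus_xi S (m : nat) (f : {mpoly K[n.+1]}) :=
  exists a, vanishing S (f - a * xi ^+ m).

(* The scheme-theoretic fibre of xi : S -> K^1 over 0 is X, as a subscheme of
   {xi = 0} = K^n. *)
Definition special_fiber S X := forall g : {mpoly K[n]},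
  vanishing X g <-> ideal_plus_xi S 1 (subst g xtilde0).

(* K[S] is flat over K[t], t acting as xi: by the equational criterion, every
   relation \sum_i r_i f_i = 0 in K[S] follows from relations in K[t]. *)
Definition flat_over_line S :=
  forall (m : nat) (r : 'I_m -> {poly K}) (f : 'I_m -> {mpoly K[n.+1]}),
    vanishing S (\sum_(i < m) horner_alg xi (r i) * f i) ->
    exists (l : nat) (a : 'I_m -> 'I_l -> {poly K})
        (e : 'I_l -> {mpoly K[n.+1]}),
      (forall i, vanishing S (f i - \sum_(j < l) horner_alg xi (a i j) * e j))
      /\ (forall j, \sum_(i < m) r i * a i j = 0).

(* Restricting xi : S -> K^1 to the double point gives the spectrum of
   B = K[xi, x]/(I(S) + (xi^2)), with epsilon = xi. For suitable lifts xt_i to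
   B of the coordinates of X, h maps g to the restriction to X of a g' such
   that g(xt) = epsilon g'(xt) in B. *)
Definition first_order_map S X (h : sections (sheaf_N X)) :=
  exists xt : 'I_n -> {mpoly K[n.+1]},
    (forall i, ideal_plus_xi S 1 (xt i - xtilde0 i)) /\
    forall g, vanishing X g -> exists g' : {mpoly K[n]},
      ideal_plus_xi S 2 (subst g xt - xi * subst g' xt) /\
      forall x, X x -> h g x = g'.@[x].

(* h represents the class in T^1(X) of this first order deformation. *)
Definition T1_class_of S X (h : sections (sheaf_N X)) :=
  conormal_dual h /\
  exists h0, [/\ conormal_dual h0, first_order_map S h0 & T1_equiv h h0].

(* The class of nu represents this first order deformation. *)
Definition represents S X U (nu : cochain (sheaf_Theta X)) :=
  (exists h, T1_class_of S (X := X) h) /\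
  forall h, T1_class_of S h -> T1_identified U h nu.

Variable k : nat.
Implicit Types (b : 'I_n.+1 -> {mpoly K[k.+1]}) (y : pt K k).

Definition polymap b (y : pt K k.+1) : pt K n.+1 := fun i => (b i).@[y].

(* (0, y) *)
Definition slice y : pt K k.+1 :=
  fun i => if unlift ord0 i is Some j then y j else 0.

(* b restricted to {y_0 = 0}, with values in {xi = 0} = K^n *)
Definition central_map b y : pt K n :=
  fun i => polymap b (slice y) (lift ord0 i).

(* db(d/dy_0) at the preimage of x under central_map b, the component along
   d/dxi being dropped *)
Definition deformation_speed X b (beta : pt K n -> pt K k) :
    sections (sheaf_On X) :=
  fun i x => ((b (lift ord0 i))^`M(ord0)).@[slice (beta x)].

End Deformation.

(* Main.v *)
(* The equation of X lifts to first order: for g in I, g(x) = xi g'(x, xi) on S,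
   and flatness makes g |-> g' mod I a well defined element v' of
   Hom(I/I^2, C[X]) that represents the deformation. Differentiating
   g(b) = y_0 g'(b) along y_0 = 0 shows that v' is the image of the field of
   deformation speeds on U', so v' is the section sought, and it is defined on
   all of X. What remains is that v' lifts to vector fields locally on U, i.e.
   the right exactness of the normal sequence. At a smooth point n - dim X
   gradients of elements of I are independent; since X is parametrized by C^k,
   comparing Hilbert functions gives dim X <= k, while the gradients of I have
   rank at most n - k where the parametrization has an inverse. Hence these
   gradients span all the others generically, and v', being generically induced
   by a vector field, is determined by its values on the chosen elements. *)
Require Import Defs.
From HB Require Import structures.
From mathcomp Require Import all_boot all_order all_algebra.
From mathcomp Require Import complex mpoly reals.
From mathcomp Require Import boolp ring zify.

Set Implicit Arguments.
Unset Strict Implicit.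
Unset Printing Implicit Defensive.

Import GRing.Theory.
Local Open Scope ring_scope.

(** * Calculus of polynomials *)

(** Constants and variables generate the polynomial ring. Identities compatible with sums and
    products then need checking only on generators. *)
Lemma mpoly_ring_ind (n : nat) (R : comNzRingType) (P : {mpoly R[n]} -> Prop) :
    (forall c, P c%:MP) -> (forall i, P 'X_i) ->
    (forall p q, P p -> P q -> P (p + q)) ->
    (forall p q, P p -> P q -> P (p * q)) ->
  forall p, P p.
Proof.
move=> PC PX PD PM; elim/mpolyind => [|c m p _ _ Pp]; first by rewrite -mpolyC0.
apply: (PD) Pp; rewrite -mul_mpolyC; apply: (PM) => //.
rewrite mpolyXE_id; apply: big_ind => [||i _]; [by rewrite -mpolyC1|exact:
  (PM)|].
by elim: (m i) => [|e IHe]; rewrite ?expr0 -?mpolyC1 // exprS; apply: PM.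
Qed.

Section Calculus.

Variable K : fieldType.

Lemma mderivXU n (i j : 'I_n) : ('X_j : {mpoly K[n]})^`M(i) = (j == i)%:R.
Proof.
rewrite mderivX mnm1E; case: eqP => [->|_]; last by rewrite scale0r.
rewrite (_ : _ - _ = 0)%MM ?mpolyX0 ?scale1r //.
by apply/mnmP => l; rewrite mnmBE subnn mnm0E.
Qed.

(** Chain rule: both sides are additive and obey the Leibniz rule in [g]. *)
Lemma mderiv_comp n m (g : {mpoly K[n]}) (t : 'I_n -> {mpoly K[m]}) (l : 'I_m) :
  (g \mPo [tuple t i | i < n])^`M(l) =
  \sum_(i < n) (g^`M(i) \mPo [tuple t i | i < n]) * (t i)^`M(l).
Proof.
elim/mpoly_ring_ind: g => [c|j|p q IHp IHq|p q IHp IHq].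
- by rewrite comp_mpolyC mderivC big1 // => i _;
  rewrite mderivC comp_mpoly0 mul0r.
- rewrite comp_mpolyXU -tnth_nth tnth_mktuple (bigD1 j) //= big1 ?addr0.
    by rewrite mderivXU eqxx rmorph1 mul1r.
  by move=> i nij; rewrite mderivXU eq_sym (negPf nij) rmorph0 mul0r.
- rewrite rmorphD mderivD IHp IHq -big_split; apply: eq_bigr => i _.
  by rewrite mderivD rmorphD mulrDl.
- rewrite rmorphM mderivM IHp IHq mulr_suml mulr_sumr -big_split.
  apply: eq_bigr => i _; rewrite mderivM rmorphD !rmorphM /= mulrDl.
  by congr (_ + _); rewrite -!mulrA //; congr (_ * _); rewrite mulrC.
Qed.

Lemma meval_mPo n m (g : {mpoly K[n]}) (t : 'I_n -> {mpoly K[m]}) (y : 'I_m ->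
  K) :
  (g \mPo [tuple t i | i < n]).@[y] = g.@[fun i => (t i).@[y]].
Proof. by rewrite comp_mpoly_meval; apply: meval_eq => i;
  rewrite tnth_mktuple. Qed.

(** Taylor expansion to first order, the remainder being only known to be a multiple of [z ^+ 2];
    with [z = xi] it computes modulo the square of [xi]. *)
Lemma taylor_linear n m (g : {mpoly K[n]}) (t s : 'I_n -> {mpoly K[m]})
    (z : {mpoly K[m]}) :
  exists c, g \mPo [tuple t i + z * s i | i < n] = g \mPo [tuple t i | i < n]
    + z * \sum_(i < n) (g^`M(i) \mPo [tuple t i | i < n]) * s i + c * z ^+ 2.
Proof.
elim/mpoly_ring_ind: g => [c|j|p q [c IHp] [d IHq]|p q [c IHp] [d IHq]].
- exists 0; rewrite !comp_mpolyC big1 ?mulr0 ?mul0r ?addr0 // => i _.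
  by rewrite mderivC comp_mpoly0 mul0r.
- exists 0; rewrite !comp_mpolyXU -!tnth_nth !tnth_mktuple (bigD1 j) //= big1.
    by rewrite mderivXU eqxx rmorph1 mul1r mul0r !addr0.
  by move=> i nij; rewrite mderivXU eq_sym (negPf nij) rmorph0 mul0r.
- exists (c + d); rewrite !rmorphD /= IHp IHq.
  under [in RHS]eq_bigr do rewrite mderivD rmorphD mulrDl.
  rewrite big_split /= mulrDr mulrDl.
  by ring.
- pose T := [tuple t i | i < n].
  set sp := \sum_(i < n) (p^`M(i) \mPo [tuple t i | i < n]) * s i in IHp.
  set sq := \sum_(i < n) (q^`M(i) \mPo [tuple t i | i < n]) * s i in IHq.
  have -> : \sum_(i < n) ((p * q)^`M(i) \mPo [tuple t i | i < n]) * s i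
      = sp * (q \mPo [tuple t i | i < n]) + (p \mPo [tuple t i | i < n]) * sq.
    rewrite mulr_suml mulr_sumr -big_split; apply: eq_bigr => i _.
    rewrite mderivM rmorphD !rmorphM /= mulrDl.
    by congr (_ + _); rewrite -!mulrA //; congr (_ * _); rewrite mulrC.
  (* All terms of order at least 2 in [z] in the product of the two expansions, divided by
     [z ^+ 2]. *)
  exists (c * (q \mPo T) + d * (p \mPo T) + sp * sq + z * (sp * d + sq * c) + c
    * d * z ^+ 2).
  by rewrite rmorphM /= IHp IHq /T; ring.
Qed.

End Calculus.

(** * Polynomials vanishing at every point, in characteristic zero *)

Section EvaluationZero.

Variable K : fieldType.
Hypothesis charK : [pchar K] =i pred0.

(** In characteristic zero the integers below [size p] are distinct roots, too many for a nonzero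
    [p]. *)
Lemma poly_eval_eq0 (p : {poly K}) : (forall t, p.[t] = 0) -> p = 0.
Proof.
move=> p0; apply/eqP; apply: contraT => pN0.
pose s := [seq (i%:R : K) | i <- iota 0 (size p)].
have := @max_poly_roots K p s pN0; rewrite size_map size_iota ltnn; apply.
  by apply/allP => t _; apply/rootP.
rewrite map_inj_uniq ?iota_uniq // => i j /eqP.
wlog leij : i j / (i <= j)%N => [hw|].
  by case: (leqP i j) => [/hw//|/ltnW/hw h]; rewrite eq_sym => /h.
rewrite -subr_eq0 -opprB oppr_eq0 -natrB // => /eqP ji0.
apply/eqP; rewrite eqn_leq leij -subn_eq0 /=; apply: contraT => /negPf ji.
by have := (pcharf0P K).1 charK (j - i)%N; rewrite ji0 eqxx ji.
Qed.

Lemma meval0_mcoeff0 n (p : {mpoly K[n]}) : p.@[fun=> 0] = p@_0%MM.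
Proof.
elim/mpolyind: p => [|c m p _ _ IH]; first by rewrite meval0 mcoeff0.
rewrite mevalD mevalZ mevalX IH mcoeffD mcoeffZ mcoeffX; congr (c * _ + _).
have [->|mN0] := eqVneq m 0%MM.
  by rewrite big1 // => i _; rewrite mnm0E expr0.
have /existsP[i mi] : [exists i, m i != 0%N].
  rewrite -negb_forall; apply: contra mN0 => /forallP m0.
  by apply/eqP/mnmP => i; rewrite mnm0E; apply/eqP.
by rewrite (bigD1 i) //= expr0n (negPf mi) mul0r.
Qed.

(** The restriction of [p] to the line through [y] in direction [i] is a zero polynomial in one
    variable, and its derivative at 0 is the partial derivative at [y]. *)
Lemma mderiv_eval_eq0 n (p : {mpoly K[n]}) i :
  (forall y, p.@[y] = 0) -> forall y, (p^`M(i)).@[y] = 0.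
Proof.
move=> p0 y; pose h j : {poly K} := (y j)%:P + 'X *+ (j == i).
pose line (q : {mpoly K[n]}) := mmap (@polyC K) h q.
have lineE q t : (line q).[t] = q.@[fun j => y j + t *+ (j == i)].
  elim/mpoly_ring_ind: q => [c|j|q1 q2 H1 H2|q1 q2 H1 H2].
  - by rewrite /line mmapC hornerC mevalC.
  - by rewrite /line mmapX mmap1U mevalXU hornerD hornerC hornerMn hornerX.
  - by rewrite /line rmorphD hornerD H1 H2 mevalD.
  - by rewrite /line rmorphM hornerM H1 H2 mevalM.
have line_deriv q : (line q)^`() = line q^`M(i).
  elim/mpoly_ring_ind: q => [c|j|q1 q2 H1 H2|q1 q2 H1 H2].
  - by rewrite /line mmapC mderivC rmorph0 derivC.
  - rewrite /line mmapX mmap1U mderivXU derivD derivC derivMn derivX add0r.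
    by case: (j == i); rewrite ?rmorph1 ?rmorph0.
  - by rewrite /line mderivD !rmorphD /= derivD H1 H2.
  - by rewrite /line mderivM rmorphD !rmorphM /= derivM H1 H2.
have line0 : line p = 0 by apply: poly_eval_eq0 => t; rewrite lineE.
have := lineE p^`M(i) 0; rewrite -line_deriv line0 deriv0 horner0 => ->.
by apply: meval_eq => j; rewrite mul0rn addr0.
Qed.

(** Induction on the degree of the monomial: a nonzero integer multiple of its coefficient is a
    coefficient, one degree lower, of a partial derivative, which also vanishes everywhere. *)
Lemma mpoly_eval_eq0 n (p : {mpoly K[n]}) : (forall y, p.@[y] = 0) -> p = 0.
Proof.
move=> p0; apply/mpolyP => m; rewrite mcoeff0.
move: {2}(mdeg m) (erefl (mdeg m)) => d; elim: d m p p0 => [|d IHd] m p p0 md.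
  move/eqP: md; rewrite mdeg_eq0 => /eqP ->.
  by rewrite -meval0_mcoeff0 p0.
have /existsP[i mi] : [exists i, m i != 0%N].
  rewrite -negb_forall; apply/negP => /forallP m0.
  by move: md; rewrite mdegE big1 // => i _; apply/eqP.
have eqm : (m = (m - U_(i)) + U_(i))%MM by rewrite submK // lep1mP.
have := IHd (m - U_(i))%MM _ (mderiv_eval_eq0 i p0).
rewrite mcoeff_mderiv -eqm => h; have : p@_m *+ ((m - U_(i))%MM i).+1 = 0.
  by apply: h; move: md; rewrite {1}eqm mdegD mdeg1 addn1 => -[].
move/eqP; rewrite -mulr_natr mulf_eq0 => /orP[/eqP //|].
by rewrite ((pcharf0P K).1 charK).
Qed.

End EvaluationZero.

(** * Zariski topology and regular functions *)

Section ZariskiTopology.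

Variables (K : fieldType) (n : nat).
Implicit Types (X Z U V W : pt K n -> Prop) (p q g : {mpoly K[n]}).
Implicit Types f : pt K n -> K.

Lemma zclosed_zeros p : zclosed (fun x => p.@[x] = 0).
Proof. by exists (eq p) => x; split=> [px g <-|/(_ _ erefl)]. Qed.

Lemma zclosedU Z1 Z2 :
  zclosed Z1 -> zclosed Z2 -> zclosed (fun x => Z1 x \/ Z2 x).
Proof.
move=> [E1 hE1] [E2 hE2].
exists (fun g => exists g1 g2, [/\ E1 g1, E2 g2 & g = g1 * g2]) => x; split.
  move=> Zx _ [g1 [g2 [Eg1 Eg2 ->]]]; rewrite mevalM.
  by case: Zx => [/hE1/(_ _ Eg1)|/hE2/(_ _ Eg2)] ->; rewrite ?mul0r ?mulr0.
move=> h; case: (pselect (Z1 x)) => [|nZ1]; [by left|right].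
apply/hE2 => g2 Eg2; apply: contrapT => g2x; apply: nZ1; apply/hE1 => g1 Eg1.
have /eqP := h (g1 * g2) (ex_intro _ g1 (ex_intro _ g2 (And3 Eg1 Eg2 erefl))).
by rewrite mevalM mulf_eq0 => /orP[/eqP|/eqP].
Qed.

Lemma zopenI X V W : zopen X V -> zopen X W -> zopen X (setint V W).
Proof.
move=> [Z1 cZ1 hV] [Z2 cZ2 hW]; exists (fun x => Z1 x \/ Z2 x).
  exact: zclosedU.
move=> x; split=> [[/hV[Xx nZ1] /hW[_ nZ2]]|[Xx nZ]]; first by split=> // -[].
by split; [apply/hV|apply/hW]; split=> // Zx; apply: nZ; [left|right].
Qed.

Lemma zopen_principal X p : zopen X (fun x => X x /\ p.@[x] != 0).
Proof.
exists (fun x => p.@[x] = 0); first exact: zclosed_zeros.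
by move=> x; split=> -[Xx px]; split=> //; [apply/eqP|apply/eqP].
Qed.

Lemma zopen_sub X V x : zopen X V -> V x -> X x.
Proof. by move=> [Z _ hV] /hV[]. Qed.

Lemma zopen_basis X V x : zopen X V -> V x ->
  exists2 e : {mpoly K[n]}, e.@[x] != 0 & forall y, X y -> e.@[y] != 0 -> V y.
Proof.
move=> [Z [E hE] hV] /hV[Xx nZx].
apply: contrapT => h; apply: nZx; apply/hE => e Ee.
apply: contrapT => /eqP ex; apply: h; exists e => // y Xy ey.
by apply/hV; split=> // /hE/(_ _ Ee)/eqP; rewrite (negPf ey).
Qed.

(** The zero loci of the two factors cover [X], so one of them contains it. *)
Lemma vanishing_prime X p q : irreducible X ->
  vanishing X (p * q) -> vanishing X p \/ vanishing X q.
Proof.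
move=> [_ irrX] pq0.
case: (irrX _ _ (zclosed_zeros p) (zclosed_zeros q)); [|by left|by right].
move=> x /pq0/eqP; rewrite mevalM mulf_eq0.
by case/orP=> /eqP; [left|right].
Qed.

(** [X] is covered by the zeros of [p] and the complement of [V]; the latter is proper. *)
Lemma vanishing_dense X V p : irreducible X -> zopen X V -> (exists x, V x) ->
  vanishing V p -> vanishing X p.
Proof.
move=> [_ irrX] [Z cZ hV] [x0 /hV[Xx0 nZx0]] p0.
case: (irrX _ _ (zclosed_zeros p) cZ) => [x Xx||/(_ _ Xx0)//] //.
by case: (pselect (Z x)) => [|nZx]; [right|left; apply/p0/hV].
Qed.

Lemma vanishing0 X : vanishing X (0 : {mpoly K[n]}).
Proof. by move=> x _; rewrite meval0. Qed.

Lemma vanishingMD X p g h :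
  vanishing X g -> vanishing X h -> vanishing X (p * g + h).
Proof. by move=> g0 h0 x Xx; rewrite mevalD mevalM g0 // h0 // mulr0 addr0. Qed.

Lemma regular_ext X V f f' :
  regular X V f -> (forall x, V x -> f x = f' x) -> regular X V f'.
Proof.
move=> rf ff' x Vx; have [W [p [q [oW Wx WV h]]]] := rf x Vx.
by exists W, p, q; split=> // y Wy; rewrite -ff'; [apply: h|apply: WV].
Qed.

Lemma regular_sub X V W f : zopen X W -> incl W V -> regular X V f ->
  regular X W f.
Proof.
move=> oW WV rf x Wx; have [V' [p [q [oV' V'x V'V h]]]] := rf x (WV _ Wx).
exists (setint V' W), p, q; split=> //; first exact: zopenI.
  by move=> y [].
by move=> y [V'y _]; apply: h.
Qed.

Lemma regular_fraction X V p q : zopen X V ->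
  (forall x, V x -> q.@[x] != 0) -> regular X V (fun x => p.@[x] / q.@[x]).
Proof. by move=> oV q0 x Vx; exists V, p, q; split=> // y Vy; split=> //;
  apply: q0. Qed.

Lemma regular_poly X V p : zopen X V -> regular X V (fun x => p.@[x]).
Proof.
move=> oV; apply: (@regular_ext _ _ (fun x => p.@[x] / (1 : {mpoly
  K[n]}).@[x])).
  by apply: regular_fraction => // x _; rewrite meval1 oner_neq0.
by move=> x _; rewrite meval1 divr1.
Qed.

Lemma regularD X V f f' : regular X V f -> regular X V f' ->
  regular X V (fun x => f x + f' x).
Proof.
move=> rf rf' x Vx; have [W [p [q [oW Wx WV h]]]] := rf x Vx.
have [W' [p' [q' [oW' W'x _ h']]]] := rf' x Vx.
exists (setint W W'), (p * q' + p' * q), (q * q'); split=> //.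
- exact: zopenI.
- by move=> y [Wy _]; apply: WV.
- move=> y [/h[qy ->] /h'[q'y ->]]; rewrite mevalD !mevalM.
  by split; [apply: mulf_neq0|rewrite addf_div].
Qed.

Lemma regularM X V f f' : regular X V f -> regular X V f' ->
  regular X V (fun x => f x * f' x).
Proof.
move=> rf rf' x Vx; have [W [p [q [oW Wx WV h]]]] := rf x Vx.
have [W' [p' [q' [oW' W'x _ h']]]] := rf' x Vx.
exists (setint W W'), (p * p'), (q * q'); split=> //.
- exact: zopenI.
- by move=> y [Wy _]; apply: WV.
- move=> y [/h[qy ->] /h'[q'y ->]]; rewrite !mevalM.
  by split; [apply: mulf_neq0|rewrite mulf_div].
Qed.

Lemma regularB X V f f' : zopen X V -> regular X V f -> regular X V f' ->
  regular X V (fun x => f x - f' x).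
Proof.
move=> oV rf rf'; apply: regularD => //.
apply: regular_ext (regularM (regular_poly (- 1) oV) rf') _ => x _.
by rewrite mevalN meval1 mulN1r.
Qed.

Lemma regular_sum X V m (F : 'I_m -> pt K n -> K) : zopen X V ->
  (forall i, regular X V (F i)) -> regular X V (fun x => \sum_i F i x).
Proof.
move=> oV rF; elim: m F rF => [|m IHm] F rF.
  apply: regular_ext (regular_poly 0 oV) _ => x _.
  by rewrite big_ord0 meval0.
apply: regular_ext (regularD (rF ord0) (IHm _ (fun i => rF (lift ord0 i)))) _.
by move=> x _; rewrite big_ord_recl.
Qed.

End ZariskiTopology.

(** * Dimension of a parametrized variety *)

Section Dimension.

Variable K : fieldType.

Lemma msizeM_leq n (p q : {mpoly K[n]}) :
  (msize (p * q) <= (msize p + msize q).-1)%N.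
Proof.
have [->|pN0] := eqVneq p 0; first by rewrite mul0r msize0.
have [->|qN0] := eqVneq q 0; first by rewrite mulr0 msize0.
by rewrite msizeM.
Qed.

Definition independent_on n (Z : pt K n -> Prop) (T : finType)
    (F : T -> {mpoly K[n]}) :=
  forall c : T -> K, vanishing Z (\sum_a c a *: F a) -> forall a, c a = 0.

(** All monomials that occur lie in the box of exponents below [M], so the matrix of coefficients
    has [M ^ k] columns, and independence makes its rows free. *)
Lemma card_independent_mpoly k M (T : finType) (F : T -> {mpoly K[k]}) :
    (forall a, msize (F a) <= M)%N ->
    (forall c : T -> K, \sum_a c a *: F a = 0 -> forall a, c a = 0) ->
  (#|T| <= M ^ k)%N.
Proof.
move=> szF indF; pose E := {ffun 'I_k -> 'I_M}.
have <- : #|E| = (M ^ k)%N by rewrite card_ffun !card_ord.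
pose mon (f : E) : 'X_{1..k} := [multinom (f i : nat) | i < k].
pose A := \matrix_(a < #|T|, j < #|E|) (F (enum_val a))@_(mon (enum_val j)).
suff Afree : row_free A by rewrite -(eqP Afree) rank_leq_col.
rewrite -kermx_eq0; apply/eqP/row_matrixP => r; rewrite row0.
set v := row r _; have vA : v *m A = 0 by apply/sub_kermxP; apply: row_sub.
pose c a := v 0 (enum_rank a).
suff c0 : forall a, c a = 0.
  by apply/rowP => a; rewrite [RHS]mxE -(c0 (enum_val a)) /c enum_valK.
apply: indF; apply/mpolyP => m; rewrite mcoeff0 raddf_sum /=.
have [lt_mM|[l]] : (forall i, m i < M)%N \/ exists l, (M <= m l)%N.
    case: (pselect (forall i, m i < M)%N) => [|/existsNP[l /negP]].
      by left.
    by rewrite -leqNgt; right; exists l.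
pose f : E := [ffun i => Ordinal (lt_mM i)].
have mE : mon f = m by apply/mnmP => i; rewrite mnmE ffunE.
move/rowP/(_ (enum_rank f)): vA; rewrite mxE [X in _ = X -> _]mxE => vAm.
rewrite -[RHS]vAm [RHS](reindex (@enum_rank T));
  last exact/onW_bij/enum_rank_bij.
by apply: eq_bigr => a _; rewrite mcoeffZ [A _ _]mxE !enum_rankK mE.
(* A monomial outside the box has degree at least [M] and occurs in no [F a]. *)
move=> leMm; apply: big1 => a _.
rewrite mcoeffZ (memN_msupp_eq0 (m := m)) ?mulr0 //.
apply: msize_mdeg_ge; apply: leq_trans (szF a) (leq_trans leMm _).
by rewrite mdegE (bigD1 l) //= leq_addr.
Qed.

(** On [Z] only the term of exponent 0 survives, so its coefficients vanish. The rest is divisible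
    by [f], which cancels because the ideal of [Z'] is prime; then induct on [N]. *)
Lemma independent_powers n (Z Z' : pt K n -> Prop) f (T : finType)
    (F : T -> {mpoly K[n]}) N (c : T -> nat -> K) :
    irreducible Z' -> incl Z Z' -> vanishing Z f -> ~ vanishing Z' f ->
    independent_on Z F ->
    vanishing Z' (\sum_(j < N) (\sum_a c a j *: F a) * f ^+ j) ->
  forall a j, (j < N)%N -> c a j = 0.
Proof.
move=> irrZ' ZZ' fZ fZ' indF; elim: N c => [//|N IHN] c.
rewrite big_ord_recl expr0 mulr1 /= => h.
have c0 : forall a, c a 0%N = 0.
  apply: indF => x Zx; have := h x (ZZ' _ Zx); rewrite mevalD.
  rewrite [X in _ + X](_ : _ = 0) ?addr0 // raddf_sum big1 // => j _.
  by rewrite /= mevalM exprS mevalM fZ // mul0r mulr0.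
have {}h : vanishing Z' (f * \sum_(j < N) (\sum_a c a j.+1 *: F a) * f ^+ j).
  move=> x Z'x; rewrite -(h x Z'x); congr (_.@[_]).
  rewrite [X in _ = X + _]big1 => [|a _]; last by rewrite c0 scale0r.
  rewrite add0r mulr_sumr; apply: eq_bigr => j _.
  by rewrite /bump /= exprS mulrCA.
case: (vanishing_prime irrZ' h) => // h' a [|j] // ltj.
exact: (IHN (fun a j => c a j.+1)).
Qed.

(** Each strict inclusion supplies a function [f] vanishing on the smaller variety only; multiplying
    by its first [N] powers multiplies the size of the family by [N]. The slope [D] of the degree
    bound does not depend on [N]. *)
Lemma chain_independent n k (t : n.-tuple {mpoly K[k]})
    (Zs : nat -> pt K n -> Prop) c :
    (forall i, (i <= c)%N -> variety (Zs i)) ->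
    (forall i, (i < c)%N ->
       incl (Zs i) (Zs i.+1) /\ ~ incl (Zs i.+1) (Zs i)) ->
  exists D, forall N, exists (T : finType) (F : T -> {mpoly K[n]}),
    [/\ #|T| = (N ^ c)%N, forall a, (msize (F a \mPo t) <= (D * N).+1)%N &
        independent_on (Zs c) F].
Proof.
elim: c => [|c IHc] varZ stepZ.
  exists 0%N => N; exists 'I_1, (fun=> 1); split;
    first by rewrite card_ord expn0.
    by move=> _; rewrite comp_mpoly1 msize1.
  have [_ [[x Zx] _]] := varZ 0%N isT.
  by move=> d /(_ x Zx); rewrite big_ord1 mevalZ meval1 mulr1 => d0 a;
    rewrite ord1.
have [D hD] := IHc (fun i h => varZ i (leqW h)) (fun i h => stepZ i (leqW h)).
have [ZZ' /existsNP[x /not_implyP[Z'x nZx]]] := stepZ c (leqnn _).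
have [[E hE] _] := varZ c (leqnSn c).
have [f [Ef fx]] : exists f, E f /\ f.@[x] <> 0.
  apply: contrapT => h; apply: nZx; apply/hE => g Eg.
  by apply: contrapT => gx; apply: h; exists g.
have fZ : vanishing (Zs c) f by move=> y /hE; apply.
have fZ' : ~ vanishing (Zs c.+1) f by move/(_ _ Z'x).
exists (D + msize (f \mPo t))%N => N; have [T [F [cardT szF indF]]] := hD N.
exists (T * 'I_N)%type, (fun aj : T * 'I_N => F aj.1 * f ^+ aj.2); split.
- by rewrite card_prod cardT card_ord expnSr.
- have predD_leq a a' u u' :
    (a <= a' -> u <= u'.+1 -> (a + u).-1 <= a' + u')%N by lia.
  have szX j : (msize (f ^+ j \mPo t) <= (msize (f \mPo t) * j).+1)%N.
    elim: j => [|j IHj]; first by rewrite expr0 comp_mpoly1 msize1.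
    rewrite exprS rmorphM /=; apply: leq_trans (msizeM_leq _ _) _.
    by rewrite mulnS -addnS; apply: predD_leq (leqnn _) (leqW IHj).
  move=> [a j] /=; rewrite rmorphM /=; apply: leq_trans (msizeM_leq _ _) _.
  rewrite mulnDl -addSn; apply: predD_leq (szF a) _.
  by apply: leq_trans (szX j) _; rewrite ltnS leq_mul2l (ltnW (ltn_ord j)) orbT.
- move=> d h [a j].
  (* The coefficients are extended by 0 to exponents outside ['I_N]. *)
  have := @independent_powers _ _ _ f _ F N
    (fun a i => if insub i is Some j then d (a, j) else 0) _ ZZ' fZ fZ' indF.
  move=> /(_ (varZ c.+1 (leqnn _)).2) h'.
  have := h' _ a j (ltn_ord j); rewrite valK; apply.
  move=> y Zy; rewrite -[RHS](h y Zy); congr (_.@[_]).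
  transitivity (\sum_a \sum_(j < N) d (a, j) *: (F a * f ^+ j)); last first.
    by rewrite pair_bigA; apply: eq_bigr => -[].
  rewrite exchange_big.
  apply: eq_bigr => i _; rewrite mulr_suml; apply: eq_bigr => b _.
  by rewrite valK scalerAl.
Qed.

(* A chain of length d yields N^d independent polynomials of degree O(N), while
   their pullbacks lie in a space of dimension O(N^k). *)
Lemma dim_le_parametrization n k (X : pt K n -> Prop) (t : 'I_n ->
  {mpoly K[k]}) d :
  dominant (fun y i => (t i).@[y]) X -> dim_is X d -> (d <= k)%N.
Proof.
move=> domt [[_ [Zs [_ varZ stepZ ZX]]] _].
have [D hD] := chain_independent [tuple t i | i < n] varZ stepZ.
(* With [N = B.+1], the bound [(D * N).+1 ^ k] is at most [B * N ^ k], which is less than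
   [N ^ k.+1]. *)
pose B := (D.+1 ^ k)%N; have [T [F [cardT szF indF]]] := hD B.+1.
have := card_independent_mpoly szF.
rewrite cardT => /(_ _)/(leq_trans _) h; rewrite leqNgt; apply/negP => ltkd.
suff : (B.+1 ^ d <= (D * B.+1).+1 ^ k)%N.
  rewrite -{1}(subnKC ltkd) expnD expnS => le1.
  have le2 : ((D * B.+1).+1 ^ k <= B * B.+1 ^ k)%N.
    have [->|k_gt0] := posnP k; first by rewrite !expn0 muln1 expn_gt0.
    by rewrite -expnMn leq_exp2r // mulSn addSn ltnS leq_addl.
  have : (0 < B.+1 ^ (d - k.+1))%N by rewrite expn_gt0.
  have : (0 < B.+1 ^ k)%N by rewrite expn_gt0.
  by clearbody B; move: le1 le2; set u := (_ ^ k)%N; set v := (_ ^ k)%N; nia.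
(* By dominance, a relation between the pullbacks holds on [X], hence on the last variety of the
   chain. *)
apply: h => // c c0; apply: indF => x Zx.
have := domt _ (zclosed_zeros (\sum_a c a *: F a)).
apply => [y|]; last exact: ZX.
rewrite -meval_mPo (_ : comp_mpoly _ _ = 0) ?meval0 // -[RHS]c0 raddf_sum /=.
by apply: eq_bigr => a _; rewrite linearZ.
Qed.

End Dimension.

(** * Jacobian of a parametrization and rank of the gradients of the ideal *)

Section Parametrization.

Variable K : fieldType.
Hypothesis charK : [pchar K] =i pred0.
Variables (n k : nat) (X : pt K n -> Prop) (t : 'I_n -> {mpoly K[k]}).

Definition eval_map (y : pt K k) : pt K n := fun i => (t i).@[y].

Hypothesis t_to_X : forall y, X (eval_map y).

Definition jacobian (y : pt K k) : 'M[K]_(n, k) :=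
  \matrix_(i, l) ((t i)^`M(l)).@[y].

(** Differentiating [beta (eval_map y) = y] shows that the differential of the inverse, computed
    from local fractions [p / q], is a left inverse. *)
Lemma jacobian_left_inverse U beta x :
    rational_inverse_on X eval_map U beta -> U x ->
  exists L : 'M_(k, n), L *m jacobian (beta x) = 1%:M.
Proof.
move=> [oU _ rbeta tK betaK] Ux; pose y0 := beta x.
pose T := [tuple t i | i < n].
have ty0 : eval_map y0 = x by apply/funext => i; apply: tK.
suff /choice[L hL] : forall j, exists v : 'I_n -> K,
    forall l, \sum_i v i * ((t i)^`M(l)).@[y0] = (j == l)%:R.
  exists (\matrix_(j, i) L j i); apply/matrixP => j l; rewrite !mxE -hL.
  by apply: eq_bigr => i _; rewrite !mxE.
move=> j; have [W [p [q [oW Wx WU h]]]] := rbeta j x Ux.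
have [e ex eW] := zopen_basis oW Wx.
(* The identity holds where [e \mPo T] is nonzero. Multiplied by this factor it holds everywhere,
   and the factor, nonzero at [y0], cancels. *)
have P0 : p \mPo T - (q \mPo T) * 'X_j = 0.
  have /eqP : (e \mPo T) * (p \mPo T - (q \mPo T) * 'X_j) = 0.
    apply: (mpoly_eval_eq0 charK) => y.
    rewrite mevalM mevalB mevalM mevalXU !meval_mPo -/(eval_map y).
    have [->|ey] := eqVneq (e.@[eval_map y]) 0; first by rewrite mul0r.
    have Wty := eW _ (t_to_X y) ey; have [qy] := h _ Wty.
    by rewrite betaK; [move=> ->; rewrite [q.@[_] * _]mulrC divfK ?subrr
      ?mulr0|apply: WU].
  rewrite mulf_eq0 => /orP[/eqP e0|/eqP //]; case/eqP: ex.
  by rewrite -ty0 -meval_mPo -/T e0 meval0.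
have [qx _] := h x Wx.
(* The quotient rule for [p / q], whose value at [x] is [y0 j]. *)
exists (fun i => ((p^`M(i)).@[x] - y0 j * (q^`M(i)).@[x]) / q.@[x]) => l.
have /(congr1 (meval y0)) := congr1 (mderiv l) P0.
rewrite mderivB mderivM mderivXU !mderiv_comp !linear0 mevalB mevalD !mevalM.
rewrite /T [(q \mPo _).@[_]]meval_mPo -/(eval_map _) ty0 mevalXU !raddf_sum /=.
under eq_bigr do rewrite mevalM meval_mPo -/(eval_map _) ty0.
under [X in _ - (X * _ + _)]eq_bigr do rewrite mevalM meval_mPo -/(eval_map _)
  ty0.
move=> /eqP; rewrite opprD addrA subr_eq0 => /eqP eq1.
apply: (mulfI qx); transitivity (q.@[x] * ((j == l)%:R : {mpoly K[k]}).@[y0]).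
  rewrite -eq1 mulr_sumr mulr_suml -sumrB; apply: eq_bigr => i _.
  by field.
by case: (j == l); rewrite ?meval1 ?meval0.
Qed.

(** Differentiating [g j \mPo t = 0] shows that the gradients annihilate the Jacobian, whose rank is
    [k]. *)
Lemma rank_gradients U beta x r (g : 'I_r -> {mpoly K[n]}) :
    rational_inverse_on X eval_map U beta -> U x ->
    (forall j, vanishing X (g j)) ->
  (\rank (\matrix_(j, i) ((g j)^`M(i)).@[x]) + k <= n)%N.
Proof.
move=> invU Ux gX; have [L hL] := jacobian_left_inverse invU Ux.
have [_ _ _ tK _] := invU.
have ty0 : eval_map (beta x) = x by apply/funext => i; apply: tK.
have /eqP <- : row_full (jacobian (beta x)) by apply/row_fullP; exists L.
apply: mulmx0_rank_max; apply/matrixP => j l; rewrite !mxE.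
have g0 : g j \mPo [tuple t i | i < n] = 0.
  apply: (mpoly_eval_eq0 charK) => y; rewrite meval_mPo.
  exact: (gX j _ (t_to_X y)).
have := congr1 (fun p => (mderiv l p).@[beta x]) g0.
rewrite /= mderiv_comp linear0 meval0 raddf_sum /= => sum0; rewrite -[RHS]sum0.
by apply: eq_bigr => i _; rewrite !mxE mevalM meval_mPo -/(eval_map _) ty0.
Qed.

End Parametrization.

(** * Local surjectivity onto the normal sheaf *)

Section LocalLift.

Variables (K : fieldType) (n : nat) (X : pt K n -> Prop).
Implicit Types (g h : {mpoly K[n]}) (x y : pt K n).

Lemma conormal_hom_lin_comb V M phi r (p g : 'I_r -> {mpoly K[n]}) h q y :
    conormal_hom X V M phi -> V y -> vanishing X h ->
    (forall j, vanishing X (g j)) ->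
  phi (q * h + \sum_j p j * g j) y
    = q.@[y] * phi h y + \sum_j (p j).@[y] * phi (g j) y.
Proof.
move=> [_ lin sq] Vy hX gX.
have phi0 : phi 0 y = 0.
  by rewrite -(mul0r (0 : {mpoly K[n]})); apply: sq => //; apply: vanishing0.
have [sX eqs] : vanishing X (\sum_j p j * g j) /\
    phi (\sum_j p j * g j) y = \sum_j (p j).@[y] * phi (g j) y.
  elim: r p g gX => [|r IHr] p g gX; first by rewrite !big_ord0; split=> //;
    apply: vanishing0.
  have [sX eqs] := IHr (p \o lift ord0) (g \o lift ord0) (fun j => gX _).
  rewrite !big_ord_recl; split; first exact: vanishingMD.
  by rewrite lin // eqs.
by rewrite lin // eqs.
Qed.

Definition gradient g x : 'rV[K]_n := \row_i (g^`M(i)).@[x].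

Definition gradients r (g : 'I_r -> {mpoly K[n]}) x : 'M[K]_(r, n) :=
  \matrix_(j, i) ((g j)^`M(i)).@[x].

(** The family [oapp g h (unlift ord0 j)] is [g] with [h] put in front. *)
Lemma gradients_extend r (g : 'I_r -> {mpoly K[n]}) h x :
    row_free (gradients g x) -> ~~ (gradient h x <= gradients g x)%MS ->
  row_free (gradients (fun j => oapp g h (unlift ord0 j)) x).
Proof.
move=> freeg nle; set g' := fun j => _.
have -> : gradients g' x = col_mx (gradient h x) (gradients g x) :> 'M_(1 + r,
  n).
  apply/matrixP => j i; rewrite !mxE; case: splitP => l jl; rewrite !mxE /g'.
    by rewrite (_ : j = ord0) ?unlift_none //; apply/val_inj;
      rewrite /= jl ord1.
  by rewrite (_ : j = lift ord0 l) ?liftK //; apply/val_inj; rewrite /= jl.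
rewrite /row_free eqn_leq rank_leq_row.
have : (r < \rank (col_mx (gradient h x) (gradients g x)))%N; last by [].
rewrite -addsmxE -{1}(eqP freeg) rank_ltmx //.
by rewrite ltmxE addsmxSr addsmx_sub negb_and nle.
Qed.

(** Free families have at most [n] members, so one of them cannot be extended; it then spans all
    gradients of the ideal. *)
Lemma max_free_gradients x : exists r (g : 'I_r -> {mpoly K[n]}),
  [/\ forall j, vanishing X (g j), row_free (gradients g x) &
      forall h, vanishing X h -> (gradient h x <= gradients g x)%MS].
Proof.
pose P r := exists g : 'I_r -> {mpoly K[n]},
  (forall j, vanishing X (g j)) /\ row_free (gradients g x).
have P0 : P 0%N by exists (fun=> 0); split; [case|rewrite /row_free -leqn0
  rank_leq_row].
have [r [[g [gX gfree]] nP]] : exists r, P r /\ ~ P r.+1.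
  apply: contrapT => hP; have {P0} : P n.+1.
    elim: (n.+1) => // r Pr; apply: contrapT => nPr; apply: hP; by exists r.
  by move=> [g [_ /eqP gfree]]; have := rank_leq_col (gradients g x);
    rewrite gfree ltnn.
exists r, g; split=> // h hX; apply: contraT => /(gradients_extend gfree) free'.
case: nP; exists (fun j => oapp g h (unlift ord0 j)); split=> // j.
by case: unliftP => [l _|_] /=; [apply: gX|].
Qed.

(** Rank-nullity for the pairing with the [r] gradients: its kernel consists of tangent vectors, as
    these gradients span the others. *)
Lemma tangent_space_dim r (g : 'I_r -> {mpoly K[n]}) x (T : {vspace 'rV[K]_n}) :
    (forall h, vanishing X h -> (gradient h x <= gradients g x)%MS) ->
    (forall w, w \in T <-> tangent_vector X x w) ->
  (n <= r + \dim T)%N.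
Proof.
move=> gspan hT; pose f := linfun (mulmxr (gradients g x)^T : 'rV[K]_n ->
  'rV[K]_r).
have dim_rV m : \dim {: 'rV[K]_m} = m by rewrite dimvf; apply: mul1n.
have := limg_ker_dim f fullv; rewrite dim_rV => {1}<-.
rewrite addnC leq_add //.
  by apply: leq_trans (dimvS (subvf _)) _; rewrite dim_rV.
apply: dimvS; apply/subvP => w; rewrite memv_cap => /andP[_].
rewrite memv_ker lfunE /= => /eqP wG; apply/hT => h /gspan/submxP[c hc].
have : w *m (gradient h x)^T = 0 by rewrite hc trmx_mul mulmxA wG mul0mx.
move=> /matrixP/(_ 0 0); rewrite !mxE => wh; rewrite -[RHS]wh.
by apply: eq_bigr => i _; rewrite !mxE.
Qed.

(* At a smooth point the gradients of r = n - dim X functions g_j of the ideal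
   are independent, so v(g_j) = sum_i w_i dg_j/dx_i can be solved for w near
   it. For any g in the ideal a multiple of g - sum_j C_j g_j then has
   vanishing gradient along X, so v kills it because v is generically induced
   by the vector field s. *)
Lemma normal_section_local_lift U U' (v : sections (sheaf_N X))
    (s : 'I_n -> pt K n -> K) x (T : {vspace 'rV[K]_n}) k :
    irreducible X -> zopen X U -> zopen X U' -> (exists y, U' y) ->
    conormal_dual v ->
    (forall g y, vanishing X g -> U' y ->
      v g y = \sum_i s i y * (g^`M(i)).@[y]) ->
    (forall y r (g : 'I_r -> {mpoly K[n]}), U' y ->
      (forall j, vanishing X (g j)) ->
      (\rank (gradients g y) + k <= n)%N) ->
    U x -> (forall w, w \in T <-> tangent_vector X x w) -> (\dim T <= k)%N ->
  exists W (w : sections (sheaf_On X)),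
    [/\ zopen X W, W x, incl W U, forall i, regular X W (w i) &
        forall g y, vanishing X g -> W y -> to_normal w g y = v g y].
Proof.
move=> irrX oU oU' U'N vX vs rk Ux hT dimT.
have Xx := zopen_sub oU Ux.
have [r [g [gX gfree gspan]]] := max_free_gradients x.
have len : (n <= r + k)%N.
  by apply: leq_trans (tangent_space_dim gspan hT) _; rewrite leq_add2l.
(* The right inverse [B] at [x] is kept constant, so the square matrix [H] below is the identity at
   [x] and its determinant [dH] is nonzero near [x]. *)
have /row_freeP[B GB] := gfree.
pose grad h : 'rV[{mpoly K[n]}]_n := \row_i h^`M(i).
pose G : 'M[{mpoly K[n]}]_(r, n) := \matrix_(j, i) (g j)^`M(i).
pose Bp := map_mx (@mpolyC n K) B.
pose H := G *m Bp; pose dH := \det H.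
have grad_eval h y : map_mx (meval y) (grad h) = gradient h y.
  by apply/rowP => i; rewrite !mxE.
have G_eval y : map_mx (meval y) G = gradients g y.
  by apply/matrixP => j i; rewrite !mxE.
have Bp_eval y : map_mx (meval y) Bp = B.
  by apply/matrixP => j i; rewrite !mxE mevalC.
have H_eval y : map_mx (meval y) H = gradients g y *m B.
  by rewrite map_mxM G_eval Bp_eval.
have dH_eval y : dH.@[y] = \det (gradients g y *m B).
  by rewrite -H_eval det_map_mx.
have dHx : dH.@[x] != 0 by rewrite dH_eval GB det1 oner_neq0.
clearbody dH.
(* Cramer's rule: where the gradient of [h] is [c *m G], the row [C h] is [dH] times [c]. *)
pose C h := grad h *m Bp *m \adj H.
have kill h : vanishing X h -> forall y, X y ->
    dH.@[y] * v h y = \sum_j (C h 0 j).@[y] * v (g j) y.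
  move=> hX.
  pose f := dH * h + \sum_j (- C h 0 j) * g j.
  have fX : vanishing X f.
    move=> y Xy; rewrite /f mevalD mevalM hX // mulr0 add0r raddf_sum big1 //
      => j _.
    by rewrite /= mevalM gX // mulr0.
  have [/(_ _ fX)[pf vf] _ _] := vX.
  (* Since [dH] is outside the prime ideal of [X] and [U'] is dense, it suffices that [dH * pf]
     vanishes on [U']. *)
  have pfX : vanishing X pf.
    have : vanishing X (dH * pf); last first.
      by case/(vanishing_prime irrX) => // /(_ x Xx)/eqP; rewrite (negPf dHx).
    apply: (vanishing_dense irrX oU' U'N) => y U'y.
    have Xy := zopen_sub oU' U'y.
    rewrite mevalM; have [->|dHy] := eqVneq (dH.@[y]) 0; first by rewrite mul0r.
    have Gfree : row_free (gradients g y).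
      apply/row_freeP; exists (B *m invmx (gradients g y *m B)).
      by rewrite mulmxA mulmxV // unitmxE -dH_eval unitfE.
    (* Otherwise [r.+1] gradients would be independent at [y], against the rank bound and [len]. *)
    have /submxP[c hc] : (gradient h y <= gradients g y)%MS.
      apply: contraT => /(gradients_extend Gfree) free'.
      have := rk y r.+1 _ U'y (_ : forall j, vanishing X (oapp g h (unlift ord0
        j))).
      move=> /(_ (fun j => ltac:(by case: unliftP => [l _|_] /=;
        [apply: gX|]))).
      by rewrite (eqP free') addSn ltnNge len.
    have Cy : map_mx (meval y) (C h) = dH.@[y] *: c.
      rewrite !map_mxM grad_eval Bp_eval map_mx_adj H_eval hc -mulmxA -mulmxA.
      by rewrite [_ *m (B *m _)]mulmxA mul_mx_adj mul_mx_scalar -dH_eval.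
    rewrite -vf // vs // big1 ?mulr0 // => i _.
    suff -> : (f^`M(i)).@[y] = 0 by rewrite mulr0.
    rewrite /f mderivD mderivM linear_sum mevalD mevalD !mevalM hX // mulr0
      add0r.
    have hci : (h^`M(i)).@[y] = \sum_j c 0 j * ((g j)^`M(i)).@[y].
      move/rowP/(_ i): hc; rewrite !mxE => ->.
      by apply: eq_bigr => j _; rewrite !mxE.
    rewrite hci mulr_sumr raddf_sum -big_split big1 // => j _.
    rewrite /= mderivM mevalD !mevalM gX // mulr0 add0r.
    have /rowP/(_ j) := Cy; rewrite mxE [X in _ = X -> _]mxE mevalN => ->.
    by rewrite mulNr mulrA subrr.
  move=> y Xy; have := vf y Xy; rewrite (pfX y Xy) /f.
  rewrite (conormal_hom_lin_comb _ _ vX Xy hX gX) => /eqP;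
    rewrite addr_eq0 => /eqP ->.
  by rewrite -sumrN; apply: eq_bigr => j _; rewrite mevalN mulNr opprK.
have /choice[vp hvp] : forall j, exists p : {mpoly K[n]},
    forall y, X y -> v (g j) y = p.@[y].
  by move=> j; have [/(_ _ (gX j))] := vX.
(* By [kill], [dH * v h] is the gradient of [h] paired with this column, so the lift is [num]
   divided by [dH]. *)
pose num i := \sum_j (Bp *m \adj H) i j * vp j.
pose W := setint U (fun y => X y /\ dH.@[y] != 0).
have oW : zopen X W by apply: zopenI oU (zopen_principal _ _).
exists W, (fun i y => (num i).@[y] / dH.@[y]); split=> //; first by move=> y [].
  by move=> i; apply: regular_fraction => // y [_ []].
move=> h y hX [_ [Xy dHy]]; apply: (mulfI dHy);
  rewrite kill // /to_normal mulr_sumr.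
under eq_bigr do rewrite mulrA mulrCA mulfV // mulr1.
rewrite /num; under eq_bigr do rewrite raddf_sum mulr_suml.
rewrite exchange_big; apply: eq_bigr => j _.
rewrite hvp // /C -mulmxA mxE raddf_sum mulr_suml; apply: eq_bigr => i _.
by rewrite /= !mevalM [grad h _ _]mxE; ring.
Qed.

End LocalLift.

(** * First order deformations *)

Section FirstOrderMaps.

Variables (K : fieldType) (n : nat).
Variables (X : pt K n -> Prop) (S : pt K n.+1 -> Prop).
Implicit Types (g h p : {mpoly K[n]}) (f : {mpoly K[n.+1]}) (s : pt K n.+1).

Definition xcoords s : pt K n := fun i => s (lift ord0 i).

Lemma subst_eval g t s : (subst g t).@[s] = g.@[fun i => (t i).@[s]].
Proof. exact: meval_mPo. Qed.

Lemma subst_xtilde0_eval g s : (subst g (@xtilde0 K n)).@[s] = g.@[xcoords s].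
Proof. by rewrite subst_eval; apply: meval_eq => i; rewrite mevalXU. Qed.

Lemma ideal_plus_xiP m f :
  ideal_plus_xi S m f <-> exists a, forall s, S s ->
    f.@[s] = a.@[s] * s ord0 ^+ m.
Proof.
split=> -[a ha]; exists a => s Ss.
  have /eqP := ha s Ss; rewrite mevalB mevalM rmorphXn /= mevalXU subr_eq0.
  by move/eqP.
by rewrite mevalB mevalM rmorphXn /= mevalXU ha // subrr.
Qed.

Lemma split_xi f : exists g c, f = subst g (@xtilde0 K n) + c * xi K n.
Proof.
elim/mpoly_ring_ind: f => [c|i|f1 f2 [g1 [c1 ->]] [g2 [c2 ->]]|f1 f2 [g1 [c1
  ->]] [g2 [c2 ->]]].
- by exists c%:MP, 0; rewrite /subst comp_mpolyC mul0r addr0.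
- case: (unliftP ord0 i) => [j ->|->].
    by exists 'X_j, 0; rewrite /subst comp_mpolyXU -tnth_nth tnth_mktuple mul0r
      addr0.
  by exists 0, 1; rewrite /subst rmorph0 mul1r add0r.
- by exists (g1 + g2), (c1 + c2); rewrite /subst rmorphD /=; ring.
- exists (g1 * g2), (c1 * subst g2 (@xtilde0 K n) + c2 * subst g1 (@xtilde0 K n)
    + c1 * c2 * xi K n).
  by rewrite /subst rmorphM /=; ring.
Qed.

(** The relation defining the first order map for the standard lifts [xtilde0]; all other lifts are
    reduced to these. *)
Definition first_order_rel g g' :=
  ideal_plus_xi S 2 (subst g (@xtilde0 K n) - xi K n * subst g' (@xtilde0 K n)).

Lemma first_order_relP g g' : first_order_rel g g' <->
  exists a, forall s, S s ->
    g.@[xcoords s] = s ord0 * g'.@[xcoords s] + a.@[s] * s ord0 ^+ 2.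
Proof.
rewrite /first_order_rel ideal_plus_xiP; split=> -[a ha]; exists a => s Ss.
  have := ha s Ss; rewrite mevalB mevalM mevalXU !subst_xtilde0_eval => <-.
  by rewrite addrC subrK.
by rewrite mevalB mevalM mevalXU !subst_xtilde0_eval ha // addrC addKr.
Qed.

Lemma first_order_relMD p g g' h h' : first_order_rel g g' ->
  first_order_rel h h' -> first_order_rel (p * g + h) (p * g' + h').
Proof.
move=> /first_order_relP[a ha] /first_order_relP[b hb]; apply/first_order_relP.
exists (subst p (@xtilde0 K n) * a + b) => s Ss.
by rewrite !mevalD !mevalM subst_xtilde0_eval ha // hb //; ring.
Qed.

(** Both factors are multiples of [xi] on [S]. Hence the first order map kills the square of the
    ideal. *)
Lemma first_order_relM g g' h h' : first_order_rel g g' ->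
  first_order_rel h h' -> first_order_rel (g * h) 0.
Proof.
move=> /first_order_relP[a ha] /first_order_relP[b hb]; apply/first_order_relP.
exists ((subst g' (@xtilde0 K n) + a * xi K n) *
        (subst h' (@xtilde0 K n) + b * xi K n)) => s Ss.
rewrite !mevalM !mevalD !mevalM !subst_xtilde0_eval mevalXU meval0 ha // hb //.
by ring.
Qed.

(* a_i is the coefficient of xi in t_i - x_i. *)
Lemma first_order_rel_lifts (t : 'I_n -> {mpoly K[n.+1]}) :
    (forall i, ideal_plus_xi S 1 (t i - xtilde0 K i)) ->
  exists a : 'I_n -> {mpoly K[n]}, forall g g',
    ideal_plus_xi S 2 (subst g t - xi K n * subst g' t) ->
    first_order_rel g (g' - \sum_i a i * g^`M(i)).
Proof.
move=> ht.
have /choice[A hA] : forall i, exists al, forall s, S s ->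
    (t i).@[s] = s (lift ord0 i) + s ord0 * al.@[s].
  move=> i; have /ideal_plus_xiP[al hal] := ht i; exists al => s Ss.
  have := hal s Ss; rewrite mevalB mevalXU expr1 => /eqP.
  by rewrite subr_eq mulrC addrC => /eqP.
have /choice[a ha] : forall i, exists a0, exists c,
    A i = subst a0 (@xtilde0 K n) + c * xi K n.
  by move=> i; apply: split_xi.
have {ha} /choice[c Ac] := ha.
pose t' i := xtilde0 K i + xi K n * A i.
have tE s : S s -> (fun i => (t i).@[s]) = (fun i => (t' i).@[s]).
  by move=> Ss; apply/funext => i; rewrite hA // /t' mevalD mevalM !mevalXU.
exists a => g g' /ideal_plus_xiP[e he]; apply/first_order_relP.
have [c1 hc1] := taylor_linear g (@xtilde0 K n) A (xi K n).
have [c2 hc2] := taylor_linear g' (@xtilde0 K n) A (xi K n).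
pose D h := \sum_i subst h^`M(i) (@xtilde0 K n) * A i.
(* The terms of order at least 2 in [xi]: the error [e], the Taylor terms of [g] and [g'], and the
   part [c] of the displacement [A] divisible by [xi]. *)
exists (e - c1 + D g' + xi K n * c2 - \sum_i subst g^`M(i) (@xtilde0 K n) * c
  i).
move=> s Ss; have := he s Ss; rewrite mevalB mevalM mevalXU !subst_eval tE //.
rewrite -!subst_eval.
have -> : subst g t' = subst g (@xtilde0 K n) + xi K n * D g + c1 * xi K n ^+ 2
  by [].
have -> : subst g' t' = subst g' (@xtilde0 K n) + xi K n * D g' + c2 * xi K n
  ^+ 2 by [].
have -> : D g = \sum_i subst (a i * g^`M(i)) (@xtilde0 K n)
    + xi K n * \sum_i subst g^`M(i) (@xtilde0 K n) * c i.
  rewrite mulr_sumr -big_split; apply: eq_bigr => i _.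
  by rewrite /= Ac /subst rmorphM /=; ring.
have -> : \sum_i subst (a i * g^`M(i)) (@xtilde0 K n)
    = subst (\sum_i a i * g^`M(i)) (@xtilde0 K n) by rewrite /subst raddf_sum.
set dg := \sum_i a i * _; set cg := \sum_i _ * c i.
rewrite !(mevalD, mevalM, mevalB, rmorphXn) /= !mevalXU !subst_xtilde0_eval.
move=> eq1.
by apply/eqP; rewrite -subr_eq0; apply/eqP; move/eqP: eq1;
  rewrite -subr_eq0 => /eqP <-; ring.
Qed.

Hypothesis flatS : flat_over_line S.
Hypothesis fiberS : special_fiber S X.

(** For the single relation [xi * f = 0], the equational criterion writes [f] with coefficients
    killed by ['X] in [{poly K}], that is, zero. *)
Lemma flat_xi_regular f : vanishing S (xi K n * f) -> vanishing S f.
Proof.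
move=> h; have [|l [a [e [he ha]]]] := @flatS 1 (fun=> 'X) (fun=> f).
  by rewrite big_ord1 /= horner_algX.
have a0 j : a ord0 j = 0.
  have /eqP := ha j; rewrite big_ord1 mulf_eq0 polyX_eq0 => /orP[//|/eqP //].
have := he ord0; rewrite big1 ?subr0 // => j _.
by rewrite a0 rmorph0 mul0r.
Qed.

Lemma first_order_rel_exists g : vanishing X g ->
  exists g', first_order_rel g g'.
Proof.
move=> /fiberS/ideal_plus_xiP[a ha]; have [g' [c eqa]] := split_xi a.
exists g'; apply/first_order_relP; exists c => s Ss.
rewrite -subst_xtilde0_eval ha // eqa mevalD mevalM subst_xtilde0_eval mevalXU.
by ring.
Qed.

(** The difference times [xi] is a multiple of the square of [xi] on [S]. Flatness cancels one [xi],
    and the special fibre turns divisibility by the other into vanishing on [X]. *)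
Lemma first_order_rel_unique g g' g'' : first_order_rel g g' ->
  first_order_rel g g'' -> forall x, X x -> g'.@[x] = g''.@[x].
Proof.
move=> /first_order_relP[a ha] /first_order_relP[b hb].
suff : vanishing X (g' - g'').
  by move=> h x /h/eqP; rewrite mevalB subr_eq0 => /eqP.
apply/fiberS/ideal_plus_xiP; exists (b - a) => s Ss.
suff : vanishing S (subst (g' - g'') (@xtilde0 K n) - (b - a) * xi K n).
  move/(_ s Ss)/eqP; rewrite mevalB mevalM mevalXU subr_eq0 => /eqP ->.
  by rewrite expr1.
apply: flat_xi_regular => {}s {}Ss.
rewrite mevalM !mevalB mevalM mevalB subst_xtilde0_eval mevalB mevalXU.
by have /eqP := ha s Ss; rewrite hb // -subr_eq0 => /eqP eq0;
  rewrite -[RHS]oppr0 -eq0; ring.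
Qed.

(** An arbitrary choice of [g'] for each [g] is a homomorphism after restriction to [X], by
    uniqueness. *)
Lemma first_order_map_exists : exists h0 : sections (sheaf_N X),
  [/\ conormal_dual h0, first_order_map S h0 &
    forall g, vanishing X g -> exists2 g', first_order_rel g g' &
      forall x, X x -> h0 g x = g'.@[x]].
Proof.
have /choice[F hF] : forall g, exists g', vanishing X g -> first_order_rel g g'.
  move=> g; case: (pselect (vanishing X g)) => [/first_order_rel_exists[g']|ng].
    by exists g'.
  by exists 0.
exists (fun g x => (F g).@[x]); split.
- split=> [g _|p g h x gX hX Xx|g h x gX hX Xx].
  + by exists (F g).
  + rewrite -mevalM -mevalD; apply: first_order_rel_unique Xx.
      by apply: hF; apply: vanishingMD.
    by apply: first_order_relMD; apply: hF.
  + rewrite -(meval0 x); apply: first_order_rel_unique Xx.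
      by apply: hF => y Xy; rewrite mevalM gX // mul0r.
    exact: first_order_relM (hF _ gX) (hF _ hX).
- exists (@xtilde0 K n); split=> [i|g gX].
    by exists 0; rewrite subrr mul0r subrr; apply: vanishing0.
  by exists (F g); split=> //; apply: hF.
- by move=> g gX; exists (F g) => //; apply: hF.
Qed.

Lemma T1_class_of_first_order (h0 : sections (sheaf_N X)) :
    conormal_dual h0 -> first_order_map S h0 -> T1_class_of S h0.
Proof.
move=> dual0 fo0; split=> //; exists h0; split=> //;
  exists (fun=> 0) => g _ x _.
by rewrite /to_normal big1 ?addr0 // => i _; rewrite meval0 mul0r.
Qed.

(** The polynomial vector field has two sources: [c] from the change of lifts, [a] from equivalence
    in [T^1]. *)
Lemma T1_class_of_eq (h0 h : sections (sheaf_N X)) :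
    (forall g, vanishing X g -> exists2 g', first_order_rel g g' &
      forall x, X x -> h0 g x = g'.@[x]) ->
    T1_class_of S h ->
  exists a : 'I_n -> {mpoly K[n]}, forall g x, vanishing X g -> X x ->
    h g x = h0 g x + to_normal (X := X) (fun i y => (a i).@[y]) g x.
Proof.
move=> rel0 [_ [h1 [_ [t [ht h1t]] [a ha]]]].
have [c hc] := first_order_rel_lifts ht.
exists (fun i => a i + c i) => g x gX Xx; rewrite ha //.
have [g1 [/hc rel1 ->//]] := h1t g gX; have [g' rel' ->//] := rel0 g gX.
rewrite (first_order_rel_unique rel' rel1 Xx) mevalB [(\sum_i _).@[x]]raddf_sum
  /= -addrA.
congr (_ + _); rewrite /to_normal -sumrN -big_split; apply: eq_bigr => i _.
by rewrite /= mevalD mevalM; ring.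
Qed.

(** Pulled back by [b], the relation is a polynomial identity in which [xi] becomes [y_0]. Its
    derivative in [y_0] at [y_0 = 0] leaves only [g'] on the right. *)
Lemma first_order_rel_speed k (b : 'I_n.+1 -> {mpoly K[k.+1]}) g g' y :
    [pchar K] =i pred0 ->
    (forall z, S (polymap b z)) -> (forall z, polymap b z ord0 = z ord0) ->
    first_order_rel g g' ->
  g'.@[central_map b y] =
    \sum_i ((b (lift ord0 i))^`M(ord0)).@[slice y] * (g^`M(i)).@[central_map b
      y].
Proof.
move=> charK bS xib /first_order_relP[a ha].
pose T := [tuple b (lift ord0 i) | i < n]; pose Tb := [tuple b i | i < n.+1].
have P0 : g \mPo T - ('X_ord0 * (g' \mPo T) + (a \mPo Tb) * 'X_ord0 ^+ 2) = 0.
  apply: (mpoly_eval_eq0 charK) => z.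
  rewrite mevalB mevalD !mevalM !mevalXU !meval_mPo -expr2.
  by have := ha _ (bS z); rewrite xib => ->; rewrite subrr.
have y0 : @slice K k y ord0 = 0 by rewrite /slice unlift_none.
have := congr1 (fun q : {mpoly K[k.+1]} => (mderiv ord0 q).@[slice y]) P0.
rewrite /= mderivB mderivD !mderivM mderivXU eqxx mderiv_comp linear0 meval0.
rewrite !(mevalB, mevalD, mevalM) !mevalXU meval1 y0 !mul0r !mulr0 !mul1r
  !addr0.
rewrite mulr0 add0r addr0 meval_mPo => /eqP.
rewrite subr_eq0 => /eqP; rewrite raddf_sum => <-; apply: eq_bigr => i _.
by rewrite /= mevalM meval_mPo mulrC.
Qed.

End FirstOrderMaps.

(** * Cech cohomology *)

Section CechCohomology.

Variables (K : fieldType) (n : nat) (X U : pt K n -> Prop).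
Implicit Types (v h : sections (sheaf_N X)) (nu : cochain (sheaf_Theta X)).

Lemma cohomologous_refl (nu : cochain (sheaf_Theta X)) :
  open_cover X U (@cov _ _ _ nu) -> cohomologous X U nu nu.
Proof.
move=> covU; exists (cidx nu), (@cov _ _ _ nu), id, id, (fun _ _ _ => 0).
have [oW _] := covU; split=> // [j|j|i j e _ x _];
  [by split=> x| |by rewrite /= !subrr].
split=> [p|c p q x _|p q x _|//]; rewrite /= ?mulr0 ?addr0 //.
by apply: regular_ext (regular_poly 0 (oW j)) _ => x _; rewrite meval0.
Qed.

Definition local_lift v W (w : sections (sheaf_On X)) :=
  [/\ zopen X W, incl W U, forall i, regular X W (w i) &
      forall g x, vanishing X g -> W x -> to_normal w g x = v g x].

(* The lifts themselves index the cover, so none has to be chosen. *)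
Lemma normal_connecting_exists v :
    (forall x, U x -> exists W w, W x /\ local_lift v W w) ->
  exists nu, normal_connecting U v nu.
Proof.
move=> liftv.
pose J := {p : (pt K n -> Prop) * sections (sheaf_On X) | local_lift v p.1 p.2}.
pose W (j : J) := (sval j).1; pose w (j : J) := (sval j).2.
have liftJ (j : J) : local_lift v (W j) (w j) by case: j.
(* Two lifts have the same image [v], so their difference kills the ideal and is a derivation of the
   coordinate ring. *)
pose D (i j : J) (p : {mpoly K[n]}) x := \sum_l (w j l x - w i l x) *
  (p^`M(l)).@[x].
pose nu : cochain (sheaf_Theta X) := @Cochain K n (sheaf_Theta X) J W D.
have covU : open_cover X U W.
  split=> [j|x]; first by have [] := liftJ j.
  split=> [/liftv[V [u [Vx hVu]]]|[j Wjx]]; last by have [_ WU _ _] := liftJ j;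
    apply: WU.
  by exists (exist _ (V, u) hVu).
have cocD : cocycle X U nu.
  split=> // [i j|i j l p _ x _]; last first.
    by rewrite /= /D -big_split; apply: eq_bigr => m _ /=; ring.
  have [oi _ ri hi] := liftJ i; have [oj _ rj hj] := liftJ j.
  have oij : zopen X (setint (W i) (W j)) by apply: zopenI.
  split=> [p|c p q x _|p q x _|g x gX [Wix Wjx]]; rewrite /= /D.
  - apply: regular_sum => // l; apply: regularM (regular_poly _ oij).
    by apply: regularB => //; [apply: regular_sub (rj l)|apply: regular_sub (ri
      l)] => // y [].
  - rewrite mulr_sumr -big_split; apply: eq_bigr => l _.
    by rewrite /= mderivD mderivZ mevalD mevalZ; ring.
  - rewrite !mulr_sumr -big_split; apply: eq_bigr => l _.
    by rewrite /= mderivM mevalD !mevalM; ring.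
  - under eq_bigr do rewrite mulrBl; rewrite sumrB.
    by have := hi g x gX Wix; have := hj g x gX Wjx;
      rewrite /to_normal => -> ->; rewrite subrr.
exists nu; split=> //; exists nu, w; split=> //; last exact: cohomologous_refl.
  by move=> i; have [_ _ ri hi] := liftJ i; split=> // g gX x Wx; apply: hi.
move=> i j l _ x _; rewrite /= /psi /D (bigD1 l) //= mderivXU eqxx meval1 mulr1.
rewrite big1 ?addr0 // => m nml.
by rewrite mderivXU eq_sym (negPf nml) meval0 mulr0.
Qed.

(** Adding one global vector field to all local lifts leaves their differences, hence the cocycle,
    unchanged. *)
Lemma normal_connecting_shift v h nu (a : 'I_n -> {mpoly K[n]}) :
    (forall g x, vanishing X g -> X x ->
      h g x = v g x + to_normal (X := X) (fun i y => (a i).@[y]) g x) ->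
  normal_connecting U v nu -> normal_connecting U h nu.
Proof.
move=> hE [cocnu [z [w [cocz hw zw znu]]]]; split=> //.
have [[oz _] _ _] := cocz.
exists z, (fun i l x => w i l x + (a l).@[x]); split=> // [i|i j l _ x cx].
  have [ri wv] := hw i; split=> [l|g gX x cx].
    by apply: regularD => //; apply: regular_poly.
  rewrite hE //; last exact: zopen_sub (oz i) cx.
  rewrite -(wv g gX x cx) /to_normal -big_split; apply: eq_bigr => l _.
  by rewrite /= mulrDl.
by rewrite (zw i j l I x cx); ring.
Qed.

(** The local lifts [w] bound the image of [z]; subtracting [psi (b j)] accounts for passing from
    [z] to the cohomologous [nu]. *)
Lemma normal_connecting_psi_trivial v nu : normal_connecting U v nu ->
  cohomologous X U (map_cochain (@psi K n X) nu) (zero_cochain (sheaf_On X) U).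
Proof.
move=> [_ [z [w [cocz hw zw [J [W [r [r' [b [covW Wsub regb znu]]]]]]]]]].
exists J, W, r', (fun=> tt), (fun j l x => w (r j) l x - psi (b j) l x).
have [oW WU] := covW; split=> //.
- move=> j; have [_ Wr'] := Wsub j; split=> // x Wx.
  by apply/WU; exists j.
- move=> j l; have [Wr _] := Wsub j; have [rw _] := hw (r j).
  apply: regularB => //; first exact: regular_sub (rw l).
  by have [rb _ _ _] := regb j; apply: rb.
- move=> i j l _ x [Wix Wjx].
  have zx : setint (cov (r i)) (cov (r j)) x.
    by split; [apply: (Wsub i).1|apply: (Wsub j).1].
  have /= nuE := znu i j 'X_l I x (conj Wix Wjx).
  have := zw (r i) (r j) l I x zx; rewrite /= /psi => zE; rewrite zE in nuE.
  by rewrite subr0 -[LHS](subKr (w (r j) l x - w (r i) l x)) nuE; ring.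
Qed.

End CechCohomology.

(** * The field of deformation speeds and the class of the deformation *)

Theorem proposition6p17 (R : realType) (n k : nat)
    (X : pt R[i] n -> Prop) (S : pt R[i] n.+1 -> Prop)
    (b : 'I_n.+1 -> {mpoly R[i][k.+1]})
    (U U' : pt R[i] n -> Prop) (beta : pt R[i] n -> pt R[i] k)
    (varX : variety X) (normalX : normal_variety X)
    (varS : variety S) (flatS : flat_over_line S)
    (fiberS : special_fiber S X)
    (b_to_S : forall y, S (polymap b y)) (b_dominant : dominant (polymap b) S)
    (xi_b : forall y, polymap b y ord0 = y ord0)
    (b0_to_X : forall y, X (central_map b y))
    (b0_dominant : dominant (central_map b) X)
    (b0_birational : birational X (central_map b))
    (openU : zopen X U) (smoothU : forall x, U x -> smooth_at X x)
    (codimU : codim_ge X (setminus X U) 2)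
    (U'_sub_U : incl U' U)
    (inverse_b0 : rational_inverse_on X (central_map b) U' beta) :
  exists v' : sections (sheaf_N X),
    [/\ @sec _ _ (sheaf_N X) U v',
        eq_on U' v' (to_normal (deformation_speed (X := X) b beta)),
        exists nu, normal_connecting U v' nu &
        forall nu, normal_connecting U v' nu -> represents S U nu].
Proof.
have charC : [pchar R[i]] =i pred0 := Num.Theory.pchar_num _.
have [irrX XU'] := (varX.2, inverse_b0).
(* Substituting 0 for [y_0] presents [central_map b] by polynomials in [k] variables. *)
pose tslice : 'I_k.+1 -> {mpoly R[i][k]} :=
  fun j => if unlift ord0 j is Some l then 'X_l else 0.
pose t i := b (lift ord0 i) \mPo [tuple tslice j | j < k.+1].
have tE : eval_map t = central_map b.
  apply/funext => y; apply/funext => i; rewrite /eval_map /t meval_mPo.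
  apply: meval_eq => j; rewrite /tslice /slice.
  by case: (unlift ord0 j) => [l|]; rewrite ?mevalXU ?meval0.
have [oU' U'N _ tK _] := inverse_b0.
have [v [dual_v fo_v rel_v]] := first_order_map_exists flatS fiberS.
have v_speed g x : vanishing X g -> U' x ->
    v g x = to_normal (deformation_speed (X := X) b beta) g x.
  move=> gX U'x; have [g' rel_g ->] := rel_v g gX;
    last exact: zopen_sub oU' U'x.
  have bx : central_map b (beta x) = x by apply/funext => i; apply: tK.
  have := first_order_rel_speed (beta x) charC b_to_S xi_b rel_g.
  by rewrite bx.
have rank_le y r (g : 'I_r -> {mpoly R[i][n]}) : U' y ->
    (forall j, vanishing X (g j)) -> (\rank (gradients g y) + k <= n)%N.
  move=> U'y gX.
  have tX z : X (eval_map t z) by rewrite tE.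
  have inv_t : rational_inverse_on X (eval_map t) U' beta by rewrite tE.
  exact: (rank_gradients charC tX inv_t U'y gX).
have v_conn : exists nu, normal_connecting U v nu.
  apply: normal_connecting_exists => x Ux.
  have [d [T [dimX hT dimT]]] := smoothU x Ux.
  have dom_t : dominant (eval_map t) X by rewrite tE.
  have dk : (d <= k)%N := dim_le_parametrization dom_t dimX.
  rewrite -dimT in dk.
  have [W [w [oW Wx WU rw hw]]] :=
    normal_section_local_lift irrX openU oU' U'N dual_v v_speed rank_le Ux hT
      dk.
  by exists W, w.
exists v; split=> //.
- have [vX lin sq] := dual_v; have UX x := @zopen_sub _ _ X U x openU.
  split=> [g gX|p g h x gX hX /UX|g h x gX hX /UX]; [|exact: lin|exact: sq].
  have [p vp] := vX g gX; apply: regular_ext (regular_poly p openU) _ =>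
    x /UX Xx.
  by rewrite vp.
- by move=> g gX x U'x; apply: v_speed.
- move=> nu conn; split; first by exists v; apply: T1_class_of_first_order.
  (* Any representative of the class differs from [v] by a polynomial vector field and so has the
     same image under the connecting map. *)
  move=> h hT1; have [a ha] := T1_class_of_eq flatS fiberS rel_v hT1.
  split; first exact: hT1.1.
    exact: normal_connecting_shift ha conn.
  exact: normal_connecting_psi_trivial conn.
Qed.
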